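(* Let $m,n\ge 1$ be integers, let $\xi^1,\dots,\xi^m$ be particles in a set $\mathsf{X}$ with weights $\omega^1,\dots,\omega^m\ge 0$, $\sum_{i=1}^m\omega^i=1$, and let $f:\mathsf{X}\to\mathbb{R}$ be a function. Let $\tilde\xi_{\mathrm{rs}}^1,\dots,\tilde\xi_{\mathrm{rs}}^n$ be obtained by combined residual–stratified resampling, $\tilde\xi_{\mathrm{res}}^1,\dots,\tilde\xi_{\mathrm{res}}^n$ by residual resampling, and $\tilde\xi_{\mathrm{mult}}^1,\dots,\tilde\xi_{\mathrm{mult}}^n$ by multinomial resampling, all from the same weighted particles. Then $$\operatorname{Var}\Big[\tfrac1n\sum_{i=1}^n f(\tilde\xi_{\mathrm{rs}}^i)\,\Big|\,\mathcal{G}\Big]\;\le\;\operatorname{Var}\Big[\tfrac1n\sum_{i=1}^n f(\tilde\xi_{\mathrm{res}}^i)\,\Big|\,\mathcal{G}\Big]\;\le\;\operatorname{Var}\Big[\tfrac1n\sum_{i=1}^n f(\tilde\xi_{\mathrm{mult}}^i)\,\Big|\,\mathcal{G}\Big].$$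
   Context: $\mathcal{G}$ denotes the $\sigma$-field with respect to which the particles $\xi^i$ and normalized weights $\omega^i$ are measurable; conditionally on $\mathcal{G}$ they are fixed and the only randomness is that of the resampling. For a probability vector $p=(p^1,\dots,p^m)$ and $u\in(0,1]$ let $D_p^{\mathrm{inv}}(u)=i$ if $u\in(\sum_{j=1}^{i-1}p^j,\sum_{j=1}^{i}p^j]$. Multinomial resampling: $\tilde\xi^i=\xi^{I^i}$ with $I^i=D_\omega^{\mathrm{inv}}(U^i)$, where $U^1,\dots,U^n$ are i.i.d. uniform on $(0,1]$ and independent of $\mathcal{G}$. Residual resampling: let $R=\sum_{i=1}^m\lfloor n\omega^i\rfloor$ and, if $R<n$, $\bar\omega^i=(n\omega^i-\lfloor n\omega^i\rfloor)/(n-R)$, $i=1,\dots,m$. First copy each $\xi^i$ exactly $\lfloor n\omega^i\rfloor$ times; the remaining $n-R$ particles are $\xi^{\bar I^1},\dots,\xi^{\bar I^{n-R}}$ with $\bar I^i=D_{\bar\omega}^{\mathrm{inv}}(U^i)$, where, conditionally on $\mathcal{G}$, $U^1,\dots,U^{n-R}$ are i.i.d. uniform on $(0,1]$. (If $R=n$ no random draw is made.) Combined residual–stratified resampling: the same as residual resampling, except that the uniforms used for the $n-R$ residual indices are stratified: conditionally on $\mathcal{G}$, $U^1,\dots,U^{n-R}$ are independent with $U^i$ uniform on $((i-1)/(n-R),\,i/(n-R)]$. *)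

(* Defs.v *)
From HB Require Import structures.
From mathcomp Require Import all_boot all_order all_algebra.
From mathcomp Require Import all_classical all_reals all_analysis.

Set Implicit Arguments.
Unset Strict Implicit.
Unset Printing Implicit Defensive.

Import Order.TTheory GRing.Theory Num.Theory.
Import numFieldNormedType.Exports.

Local Open Scope classical_set_scope.
Local Open Scope ring_scope.

(* Everything is stated conditionally on the sigma-field G making the
   particles and weights measurable: particles and weights are constants, and
   the probability P below plays the role of the conditional law given G, so that
   'V_P[_] is Var[_ | G]. *)

Section resampling.
Variables (R : realType) (X : Type) (m n : nat).

(* At most one i satisfies the test when p >= 0. The default value
   (Ordinal hm) is only used for u outside (0, \sum_i p i]. *)
Definition Dinv (hm : (0 < m)%N) (p : 'I_m -> R) (u : R) : 'I_m :=
  odflt (Ordinal hm)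
    [pick i : 'I_m | \sum_(j < m | (j < i)%N) p j < u
                     <= \sum_(j < m | (j <= i)%N) p j].

Definition mult_resample (hm : (0 < m)%N) (xi : 'I_m -> X) (w : 'I_m -> R)
    (u : 'I_n -> R) : seq X :=
  [seq xi (Dinv hm w (u k)) | k <- enum 'I_n].

(* Num.truncn is the floor, as a natural number, of a nonnegative real. *)
Definition ncopies (w : 'I_m -> R) (i : 'I_m) : nat :=
  Num.truncn (n%:R * w i).

Definition nresid (w : 'I_m -> R) : nat := (n - \sum_(i < m) ncopies w i)%N.

(* When nresid w = 0 this is the junk value 0 but no index is drawn. *)
Definition resid_weight (w : 'I_m -> R) (i : 'I_m) : R :=
  (n%:R * w i - (ncopies w i)%:R) / (nresid w)%:R.

(* Residual and residual-stratified resampling share this map; they differ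
   only in the law of the uniforms u. *)
Definition resid_resample (hm : (0 < m)%N) (xi : 'I_m -> X) (w : 'I_m -> R)
    (u : 'I_(nresid w) -> R) : seq X :=
  flatten [seq nseq (ncopies w i) (xi i) | i <- enum 'I_m] ++
  [seq xi (Dinv hm (resid_weight w) (u k)) | k <- enum 'I_(nresid w)].

Definition resample_mean (f : X -> R) (s : seq X) : R :=
  n%:R^-1 * \sum_(x <- s) f x.

End resampling.

Arguments ncopies {R m} n w i.
Arguments nresid {R m} n w.
Arguments resid_weight {R m} n w i.
Arguments mult_resample {R X m n} hm xi w u.
Arguments resid_resample {R X m n} hm xi w u.
Arguments resample_mean {R X} n f s.

Section laws.
Variables (R : realType) (d : measure_display) (T : measurableType d).
Variable P : probability T R.

(* uniform_prob lives on [a, b]; the half-open interval (a, b] has the same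
   uniform law. *)
Definition uniform_on (U : {RV P >-> R}) (a b : R) : Prop :=
  exists ab : a < b,
    forall A : set R, measurable A -> distribution P U A = uniform_prob ab A.

Definition mutually_independent (I : finType) (U : I -> {RV P >-> R}) : Prop :=
  forall (J : {set I}) (A : I -> set R), (forall i, measurable (A i)) ->
    P [set t | forall i, i \in J -> A i (U i t)] =
    (\prod_(i in J) P (U i @^-1` A i))%E.

Definition iid_uniform (N : nat) (U : 'I_N -> {RV P >-> R}) : Prop :=
  mutually_independent U /\ forall k, uniform_on (U k) 0 1.

Definition stratified_uniform (N : nat) (U : 'I_N -> {RV P >-> R}) : Prop :=
  mutually_independent U /\
  forall k : 'I_N, uniform_on (U k) (k%:R / N%:R) (k.+1%:R / N%:R).

End laws.

(* Main.v *)
(** Each scheme draws, besides the deterministic copies, independent indices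
    I^1, ..., I^N, so its variance is the sum over k of the variances of
    f(xi^(I^k)), up to the common factor n^-2. The law of I^k is the Lebesgue
    measure of the pieces cut out of (0, 1], or of the k-th stratum, by the
    partial sums of the weights. The strata tile (0, 1], so in the stratified
    case the laws of I^1, ..., I^N add up to N times the weights. As a mean
    minimizes the mean squared deviation, replacing the means of the strata by
    the global mean gives the first inequality. The second one follows by
    centering the residual draws at the multinomial mean M and adding the terms
    floor(n w^i) (f(xi^i) - M)^2 >= 0. *)

Require Import Defs.
From HB Require Import structures.
From mathcomp Require Import all_boot all_order all_algebra.
From mathcomp Require Import all_classical all_reals all_analysis.
From mathcomp Require Import ring.

Set Implicit Arguments.
Unset Strict Implicit.
Unset Printing Implicit Defensive.

Import Order.TTheory GRing.Theory Num.Theory.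
Import numFieldNormedType.Exports.

Local Open Scope classical_set_scope.
Local Open Scope ring_scope.

(** * Mean squared deviations *)

(** The right side minus the left side is [(m - x) ^+ 2], where [m] is the mean under [q]. *)
Lemma sum_sqr_dev_le (R : realType) (I : finType) (q h : I -> R) (x : R) :
  \sum_i q i = 1 ->
  \sum_i (h i - \sum_j h j * q j) ^+ 2 * q i <= \sum_i (h i - x) ^+ 2 * q i.
Proof.
move=> q1; set m := \sum_j h j * q j; rewrite -subr_ge0 -sumrB.
rewrite (eq_bigr (fun i => 2 * (m - x) * (h i * q i) +
                           (x ^+ 2 - m ^+ 2) * q i)).
  rewrite big_split/= -!mulr_sumr q1 -/m.
  by rewrite [leRHS](_ : _ = (m - x) ^+ 2) ?sqr_ge0//; ring.
by move=> i _; ring.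
Qed.

(** * Finite-valued random variables and the variance of their sums *)

Section finite_valued.
Context (R : realType) (d : measure_display) (T : measurableType d).
Variable P : probability T R.

(** Measurability is asked of the level sets, [I] being a bare finite type; [phi (J t)] is then a
    combination of their indicators. *)
Lemma expectation_comp_fin (I : finType) (J : T -> I) (phi : I -> R) :
    (forall i, measurable (J @^-1` [set i])) ->
  'E_P[fun t => phi (J t)]%E =
  (\sum_i phi i * fine (P (J @^-1` [set i])))%:E.
Proof.
move=> mJ; rewrite unlock.
transitivity (\int[P]_t \sum_i ((phi i)%:E * (\1_(J @^-1` [set i]) t)%:E))%E.
  apply: eq_integral => t _; rewrite (bigD1 (J t))//= indicE mem_set//= mule1.
  rewrite big1 ?adde0// => i /negP iJ.
  by rewrite indicE memNset ?mule0//= => Ji; apply: iJ; rewrite Ji.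
have intI i : P.-integrable setT (fun t => (\1_(J @^-1` [set i]) t)%:E).
  by apply: integrable_indic => //; rewrite fin_num_measure.
rewrite integral_sum//; last by move=> i; exact: integrableZl.
rewrite -sumEFin; apply: eq_bigr => i _.
rewrite integralZl// integral_indic// setIT EFinM fineK//.
by rewrite fin_num_measure.
Qed.

Lemma sum_probability_fin (I : finType) (J : T -> I) :
    (forall i, measurable (J @^-1` [set i])) ->
  \sum_i fine (P (J @^-1` [set i])) = 1.
Proof.
move=> mJ; apply: EFin_inj; rewrite -(expectation_cst P 1).
rewrite (expectation_comp_fin (fun=> 1) mJ).
by congr EFin; apply: eq_bigr => i _; rewrite mul1r.
Qed.

(** Pairwise independence kills the cross terms of the centered sum. The constant [a] will hold the
    deterministic copies. *)
Lemma variance_sum_fin (N : nat) (I : finType) (J : 'I_N -> T -> I)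
    (h : I -> R) (c a : R) :
    (forall k i, measurable (J k @^-1` [set i])) ->
    (forall k l i j, k != l ->
      P ((J k @^-1` [set i]) `&` (J l @^-1` [set j])) =
      (P (J k @^-1` [set i]) * P (J l @^-1` [set j]))%E) ->
  let q k i := fine (P (J k @^-1` [set i])) in
  'V_P[fun t => (c * (a + \sum_k h (J k t)))%R]%E =
  (c ^+ 2 * \sum_k \sum_i (h i - \sum_j h j * q k j) ^+ 2 * q k i)%:E.
Proof.
move=> mJ indepJ q.
(* The joint vector [V] takes finitely many values, so [e], the expectation under its law, is a
   finite sum and needs no integrability checks. *)
pose V t := [ffun k => J k t].
have mV v : measurable (V @^-1` [set v]).
  rewrite [X in measurable X](_ : _ =
      \bigcap_(k in setT) (J k @^-1` [set v k])).
    by apply: fin_bigcap_measurable => // k _; exact: mJ.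
  apply/seteqP; split => [t /= <- k _/=|t /= tJ].
    by rewrite ffunE.
  by apply/ffunP => k; rewrite ffunE; exact: tJ.
pose e (psi : {ffun 'I_N -> I} -> R) :=
  \sum_v psi v * fine (P (V @^-1` [set v])).
have eE psi : 'E_P[fun t => psi (V t)]%E = (e psi)%:E
  by exact: expectation_comp_fin.
have e1 k (g : I -> R) : e (fun v => g (v k)) = \sum_i g i * q k i.
  apply: EFin_inj; rewrite -eE -(expectation_comp_fin g (mJ k)).
  by congr expectation; apply/funext => t; rewrite ffunE.
have e2 k l (g g' : I -> R) : k != l -> e (fun v => g (v k) * g' (v l)) =
    (\sum_i g i * q k i) * (\sum_i g' i * q l i).
  (* The product is a function [G] of the pair [K], whose law factors by independence. *)
  move=> kl; pose G (ij : I * I) := g ij.1 * g' ij.2.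
  pose K t := (J k t, J l t).
  have KE ij : K @^-1` [set ij] =
      (J k @^-1` [set ij.1]) `&` (J l @^-1` [set ij.2]).
    by case: ij => i j; apply/seteqP; split => t /=; rewrite /K => -[-> ->].
  have mK ij : measurable (K @^-1` [set ij]) by rewrite KE; exact: measurableI.
  apply: EFin_inj; rewrite -eE.
  transitivity ('E_P[fun t => G (K t)])%E.
    by congr expectation; apply/funext => t; rewrite /G/= !ffunE.
  rewrite expectation_comp_fin// big_distrlr/= pair_big/=.
  congr EFin; apply: eq_bigr => -[i j] _.
  rewrite KE indepJ//= fineM ?fin_num_measure//.
  by rewrite /G /q/=; ring.
have eZ b psi : e (fun v => b * psi v) = b * e psi.
  by rewrite /e mulr_sumr; apply: eq_bigr => v _; rewrite mulrA.
have eS (K : finType) (psi : K -> {ffun 'I_N -> I} -> R) :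
    e (fun v => \sum_k psi k v) = \sum_k e (psi k).
  by rewrite /e exchange_big/=; apply: eq_bigr => v _; rewrite mulr_suml.
have q1 k : \sum_i q k i = 1 by exact: sum_probability_fin.
pose m k := \sum_j h j * q k j.
pose Y k i := h i - m k.
have Y0 k : \sum_i Y k i * q k i = 0.
  rewrite /Y; under eq_bigr do rewrite mulrBl.
  by rewrite sumrB -mulr_sumr q1 mulr1 subrr.
have eD b psi : e (fun v => b + psi v) = b + e psi.
  rewrite /e; under eq_bigr do rewrite mulrDl.
  by rewrite big_split/= -mulr_sumr sum_probability_fin// mulr1.
pose S (v : {ffun 'I_N -> I}) := c * (a + \sum_k h (v k)).
have SY v : S v = c * (a + \sum_k m k) + c * \sum_k Y k (v k).
  rewrite /S -mulrDr -addrA -big_split/=.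
  by under [in RHS]eq_bigr do rewrite addrC subrK.
have eSm : e S = c * (a + \sum_k m k).
  have -> : S = (fun v => c * (a + \sum_k m k) + c * \sum_k Y k (v k))
    by exact/funext.
  rewrite eD eZ eS [X in _ + _ * X]big1 ?mulr0 ?addr0// => k _.
  by rewrite e1 Y0.
rewrite (_ : (fun t => _) = (fun t => S (V t))); last first.
  apply/funext => t; rewrite /S; congr (_ * (_ + _)).
  by apply: eq_bigr => k _; rewrite ffunE.
(* [D] is the square of the centered sum, expanded as a double sum. *)
pose D (v : {ffun 'I_N -> I}) := c ^+ 2 * \sum_k \sum_l Y k (v k) * Y l (v l).
transitivity ('E_P[fun t => D (V t)])%E.
  rewrite /variance unlock; congr expectation; apply/funext => t.
  rewrite eE eSm -[LHS]/((S (V t) - c * (a + \sum_k m k)) *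
                         (S (V t) - c * (a + \sum_k m k))).
  rewrite SY /D -big_distrlr/=.
  by rewrite [c * (_ + _) + _]addrC addrK; ring.
rewrite eE; congr EFin; rewrite /D eZ eS; congr (_ * _).
apply: eq_bigr => k _; rewrite eS (bigD1 k)//= [X in _ + X]big1 ?addr0.
  rewrite (e1 k (fun i => Y k i * Y k i)).
  by apply: eq_bigr => i _; rewrite expr2.
by move=> l lk; rewrite e2 1?eq_sym// Y0 mul0r.
Qed.

End finite_valued.

(** * Uniform laws and strata *)

Section uniform_laws.
Context (R : realType).
Local Notation mu := (@lebesgue_measure R).

Lemma uniform_probE (a b : R) (ab : a < b) (A : set R) : measurable A ->
  uniform_prob ab A = ((b - a)^-1%:E * mu (A `&` `]a, b]%classic))%E.
Proof.
move=> mA; rewrite /uniform_prob integral_uniform_pdf.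
rewrite (eq_integral (fun=> (b - a)^-1%:E)); last first.
  by move=> x; rewrite inE/= in_itv/= /uniform_pdf => -[_ ->].
rewrite integral_cst//=; last exact: measurableI.
(* The endpoint [a] is split off the closed interval; a point is Lebesgue null. *)
congr (_ * _)%E; rewrite -(@setU1itv _ _ _ _ false) ?bnd_simp ?ltW//.
rewrite setIUr setUC measureU0//.
- exact: measurableI.
- exact: measurableI.
- by apply/eqP; rewrite -measure_le0 -(lebesgue_measure_set1 a) measureIr.
Qed.

(** The step [s] is kept apart from [N] so that the induction on [N] runs at fixed width; it is used
    at s = 1/N. *)
Lemma sum_lebesgue_strata (s : R) (N : nat) (A : set R) :
    0 <= s -> measurable A ->
  (\sum_(k < N) mu (A `&` `](k%:R * s)%R, (k.+1%:R * s)%R]%classic) =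
   mu (A `&` `]0%R, (N%:R * s)%R]%classic))%E.
Proof.
move=> s0 mA; elim: N => [|N IH].
  by rewrite big_ord0 mul0r set_itvoc0 setI0 measure0.
rewrite big_ord_recr/= IH -measureU; first last.
- apply/seteqP; split => // x /= [[_ +] [_ +]].
  rewrite !in_itv/= => /andP[_ xN] /andP[Nx _].
  by move: (lt_le_trans Nx xN); rewrite ltxx.
- exact: measurableI.
- exact: measurableI.
rewrite -setIUr; congr (mu (_ `&` _)); rewrite -itv_bndbnd_setU// bnd_simp.
- by rewrite mulr_ge0.
- by rewrite ler_wpM2r// ler_nat.
Qed.

(** * Preimages under the inverse distribution function *)

Section Dinv.
Variables (m : nat) (hm : (0 < m)%N) (p : 'I_m -> R).
Hypotheses (p_ge0 : forall i, 0 <= p i) (p_sum1 : \sum_i p i = 1).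

(** With these cumulative weights the test in [Dinv] reads [H i < u <= H i.+1]. *)
Let H (x : nat) : R := \sum_(j < m | (j < x)%N) p j.

Let H0 : H 0 = 0.
Proof. by rewrite /H big_pred0. Qed.

Let Hm : H m = 1.
Proof. by rewrite -p_sum1; apply: eq_bigl => j; rewrite ltn_ord. Qed.

Let H_homo : {homo H : x y / (x <= y)%N >-> x <= y}.
Proof.
move=> x y xy; rewrite /H [leRHS](bigID (fun j : 'I_m => (j < x)%N))/=.
rewrite [in leRHS](eq_bigl (fun j : 'I_m => (j < x)%N)) ?lerDl ?sumr_ge0// => j.
by case: (ltnP j x) => jx; rewrite ?andbF// (leq_trans jx xy).
Qed.

Let HS (i : 'I_m) : H i.+1 = H i + p i.
Proof.
rewrite /H (bigD1 i)//= addrC; congr (_ + _).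
by apply: eq_bigl => j; rewrite ltnS ltn_neqAle andbC.
Qed.

(** The cumulative weights stay in [0, 1], so no index passes the test. *)
Let Dinv_default (u : R) : ~~ (0 < u <= 1) -> Dinv hm p u = Ordinal hm.
Proof.
move=> u01; rewrite /Dinv; case: pickP => //= k.
rewrite -[X in X < _]/(H k) -[X in _ <= X]/(H k.+1) => /andP[ku uk]; exfalso.
move/negP: u01; apply; apply/andP; split.
  by apply: le_lt_trans ku; rewrite -H0; exact: H_homo.
by apply: (le_trans uk); rewrite -Hm; exact: H_homo (ltn_ord k).
Qed.

Let DinvP (u : R) (i : 'I_m) : 0 < u <= 1 ->
  (Dinv hm p u = i) <-> (H i < u <= H i.+1).
Proof.
move=> /andP[u0 u1].
have uniq k l : H k < u <= H k.+1 -> H l < u <= H l.+1 -> (k <= l)%N.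
  move=> /andP[ku _] /andP[_ ul]; rewrite leqNgt; apply/negP => /H_homo lk.
  by move: (lt_le_trans ku (le_trans ul lk)); rewrite ltxx.
have [k tk] : exists k : 'I_m, H k < u <= H k.+1.
  (* Take the least [x] with [u <= H x]. It is not 0, as [H 0 = 0 < u], and its predecessor [y] is
     the index sought. *)
  have exH : exists x, u <= H x by exists m; rewrite Hm.
  case: (ex_minnP exH) => -[|y] uy miny.
    by move: (lt_le_trans u0 uy); rewrite H0 ltxx.
  have ym : (y < m)%N by apply: miny; rewrite Hm.
  exists (Ordinal ym); rewrite /= uy andbT ltNge; apply/negP => /miny.
  by rewrite ltnn.
have -> : Dinv hm p u = k.
  rewrite /Dinv; case: pickP => [l tl|/(_ k)]; last by rewrite [X in X = _]tk.
  by apply/val_inj/eqP; rewrite eqn_leq !uniq.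
split=> [<-//|ti].
by apply/val_inj/eqP; rewrite eqn_leq !uniq.
Qed.

Let Dinv_preimage (i : 'I_m) :
  Dinv hm p @^-1` [set i] `&` `]0, 1]%classic = `]H i, H i.+1]%classic.
Proof.
apply/seteqP; split => u /=; rewrite !in_itv/=.
  by move=> [+ u01] => /DinvP; exact.
move=> ui; have u01 : 0 < u <= 1.
  case/andP: ui => iu ui; apply/andP; split.
    by apply: le_lt_trans iu; rewrite -H0; exact: H_homo.
  by apply: (le_trans ui); rewrite -Hm; exact: H_homo (ltn_ord i).
by split => //; exact/DinvP.
Qed.

(** The uniforms may leave (0, 1] on a null set, so the whole preimage matters, including where
    [Dinv] takes its default value. *)
Lemma measurable_Dinv_preimage (i : 'I_m) :
  measurable (Dinv hm p @^-1` [set i]).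
Proof.
rewrite -[X in measurable X](setUIDK _ `]0, 1]%classic) Dinv_preimage.
apply: measurableU => //.
(* Outside (0, 1] the preimage is everything for the default index and empty for the others. *)
have [<-|ni] := eqVneq (Ordinal hm) i.
  rewrite (_ : _ `\` _ = ~` `]0, 1]%classic); first exact: measurableC.
  apply/seteqP; split => u /=; rewrite in_itv/=; first by case.
  by move=> u01; split => //; apply: Dinv_default; exact/negP.
rewrite (_ : _ `\` _ = set0)//; apply/seteqP; split => // u /=.
rewrite in_itv/= => -[Di /negP/Dinv_default].
by rewrite Di => iE; rewrite iE eqxx in ni.
Qed.

Lemma lebesgue_Dinv_preimage (i : 'I_m) :
  mu (Dinv hm p @^-1` [set i] `&` `]0, 1]%classic) = (p i)%:E.
Proof.
rewrite Dinv_preimage lebesgue_measure_itv/= lte_fin HS ltrDl.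
(* A zero weight gives an empty interval, hence the case split on the strict order of the
   endpoints. *)
have := p_ge0 i; rewrite le_eqVlt => /predU1P[<-|pi0]; first by rewrite ltxx.
by rewrite pi0 -EFinB addrAC subrr add0r.
Qed.

End Dinv.

(** * Variance of sums driven by independent uniforms *)

Section resampling_laws.
Context (d : measure_display) (T : measurableType d) (P : probability T R).

Lemma uniform_on_preimage (U : {RV P >-> R}) (a b : R) (A : set R) :
    uniform_on U a b -> measurable A ->
  P (U @^-1` A) = ((b - a)^-1%:E * mu (A `&` `]a, b]%classic))%E.
Proof. by case=> ab UE mA; rewrite -(uniform_probE ab mA) -UE. Qed.

Lemma mutually_independent_pair (I : finType) (U : I -> {RV P >-> R})
    (k l : I) (A B : set R) :
    mutually_independent U -> k != l -> measurable A -> measurable B ->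
  P ((U k @^-1` A) `&` (U l @^-1` B)) = (P (U k @^-1` A) * P (U l @^-1` B))%E.
Proof.
(* Independence is applied to the index set {k, l}; [C] only has to be [A] at [k] and [B] at [l]. *)
move=> indU kl mA mB; pose C i := if i == k then A else B.
have mC i : measurable (C i) by rewrite /C; case: ifP.
have Ck : C k = A by rewrite /C eqxx.
have Cl : C l = B by rewrite /C eq_sym (negbTE kl).
have := indU [set k; l]%SET C mC.
rewrite big_setU1 ?inE//= big_set1 Ck Cl => <-; congr (P _).
apply/seteqP; split => [t /= [Ak Bl] i|t /= tC].
  by rewrite in_set2 => /orP[] /eqP ->; rewrite ?Ck ?Cl.
by split; [rewrite -Ck|rewrite -Cl]; apply: tC; rewrite in_set2 eqxx ?orbT.
Qed.

Variables (m : nat) (hm : (0 < m)%N).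

Section variance.
Variables (N : nat) (p : 'I_m -> R) (U : 'I_N -> {RV P >-> R}).
(* The residual weights are all 0 when there is no residual draw. *)
Hypotheses (p_ge0 : forall i, 0 <= p i) (p_sum1 : (0 < N)%N -> \sum_i p i = 1).
Variables (h : 'I_m -> R) (c a : R).

(** The index [k] witnesses [0 < N], which [p_sum1] requires. *)
Let mD (k : 'I_N) i : measurable (Dinv hm p @^-1` [set i]).
Proof.
apply: measurable_Dinv_preimage => //; apply: p_sum1.
exact: leq_ltn_trans (ltn_ord k).
Qed.

Let q k i := fine (P (U k @^-1` (Dinv hm p @^-1` [set i]))).

Let mJ k i : measurable (U k @^-1` (Dinv hm p @^-1` [set i])).
Proof. by apply: measurable_funPTI; exact: mD. Qed.

Let V := 'V_P[fun t => (c * (a + \sum_k h (Dinv hm p (U k t))))%R]%E.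

Let variance_Dinv : mutually_independent U ->
  V = (c ^+ 2 * \sum_k \sum_i (h i - \sum_j h j * q k j) ^+ 2 * q k i)%:E.
Proof.
move=> indU.
apply: (variance_sum_fin h c a (J := fun k t => Dinv hm p (U k t))).
  exact: mJ.
move=> k l i j kl.
exact: (mutually_independent_pair indU kl (mD k i) (mD l j)).
Qed.

Lemma variance_iid : iid_uniform U ->
  V = (c ^+ 2 * (N%:R * \sum_i (h i - \sum_j h j * p j) ^+ 2 * p i))%:E.
Proof.
move=> [indU unifU]; rewrite variance_Dinv//; congr (_ * _)%:E.
have qE k i : q k i = p i.
  rewrite /q (uniform_on_preimage (unifU k) (mD k i)) subr0 invr1 mul1e.
  rewrite lebesgue_Dinv_preimage//; apply: p_sum1.
  exact: leq_ltn_trans (ltn_ord k).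
rewrite -[N in RHS]card_ord -sumr_const mulr_suml; apply: eq_bigr => k _.
rewrite mul1r; apply: eq_bigr => i _; rewrite qE; congr ((_ - _) ^+ 2 * _).
by apply: eq_bigr => j _; rewrite qE.
Qed.

Lemma variance_stratified_le : stratified_uniform U ->
  (V <= (c ^+ 2 * (N%:R * \sum_i (h i - \sum_j h j * p j) ^+ 2 * p i))%:E)%E.
Proof.
move=> [indU unifU]; rewrite variance_Dinv// lee_fin ler_wpM2l ?sqr_ge0//.
set M := \sum_j h j * p j.
(* Once every stratum is recentered at [M], only the sums over [k] of [q k i] matter. *)
apply: (@le_trans _ _ (\sum_k \sum_i (h i - M) ^+ 2 * q k i)).
  apply: ler_sum => k _; apply: sum_sqr_dev_le.
  exact: (sum_probability_fin P (J := Dinv hm p \o U k) (mJ k)).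
rewrite exchange_big/= mulr_sumr ler_sum// => i _.
rewrite -mulr_sumr mulrCA ler_wpM2l ?sqr_ge0//.
have [N0|N_gt0] := posnP N.
  rewrite [in leRHS]N0 mul0r big1// => k.
  by have := ltn_ord k; rewrite [X in (_ < X)%N]N0.
have N_neq0 : N%:R != 0 :> R by rewrite pnatr_eq0 -lt0n.
(* Each stratum has width 1/N, so its uniform law is N times Lebesgue measure restricted to it, and
   the strata tile (0, 1]. *)
suff -> : \sum_k q k i = N%:R * p i by [].
apply: EFin_inj.
rewrite EFinM -(lebesgue_Dinv_preimage hm p_ge0 (p_sum1 N_gt0)).
have mDi := mD (Ordinal N_gt0) i.
have := sum_lebesgue_strata N (s := N%:R^-1) _ mDi.
rewrite mulfV// => <-; last by rewrite invr_ge0.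
rewrite -sumEFin ge0_sume_distrr//; apply: eq_bigr => k _.
rewrite /q fineK; last exact: fin_num_measure (mJ k i).
rewrite (uniform_on_preimage (unifU k) mDi); congr (_%:E * _)%E.
by rewrite -mulrBl -natrB// subSnn mul1r invrK.
Qed.

End variance.
End resampling_laws.
End uniform_laws.

(** * Residual weights *)

Section residual_weights.
Context (R : realType) (m n : nat) (w : 'I_m -> R).
Hypotheses (w_ge0 : forall i, 0 <= w i) (w_sum1 : \sum_i w i = 1).

Lemma ncopies_le i : (ncopies n w i)%:R <= n%:R * w i.
Proof. by rewrite truncn_le// mulr_ge0. Qed.

(** The truncated subtraction in [nresid] loses nothing, since the copies number at most
    [\sum_i n%:R * w i], which is n. *)
Lemma natr_nresid : (nresid n w)%:R = n%:R - \sum_i (ncopies n w i)%:R :> R.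
Proof.
rewrite natrB ?natr_sum// -(ler_nat R) natr_sum.
apply: (@le_trans _ _ (\sum_i n%:R * w i)).
  by apply: ler_sum => i _; exact: ncopies_le.
by rewrite -mulr_sumr w_sum1 mulr1.
Qed.

Let sum_frac : \sum_i (n%:R * w i - (ncopies n w i)%:R) = (nresid n w)%:R.
Proof. by rewrite sumrB -mulr_sumr w_sum1 mulr1 natr_nresid. Qed.

Lemma resid_weight_ge0 i : 0 <= resid_weight n w i.
Proof. by rewrite divr_ge0// subr_ge0 ncopies_le. Qed.

Lemma resid_weightE i :
  (ncopies n w i)%:R + (nresid n w)%:R * resid_weight n w i = n%:R * w i.
Proof.
(* With no residual draw, the fractional parts are nonnegative and sum to 0, so each vanishes. *)
rewrite /resid_weight mulrC; have [N0|N0] := eqVneq ((nresid n w)%:R : R) 0.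
  rewrite N0 mulr0 addr0; apply/esym/eqP; rewrite -subr_eq0.
  move/eqP: sum_frac; rewrite N0 psumr_eq0; last first.
    by move=> j _; rewrite subr_ge0 ncopies_le.
  by move=> /allP/(_ i); rewrite mem_index_enum => /(_ isT).
by rewrite divfK// addrC subrK.
Qed.

Lemma resid_weight_sum1 : (0 < nresid n w)%N -> \sum_i resid_weight n w i = 1.
Proof.
by move=> N0; rewrite -mulr_suml sum_frac mulfV// pnatr_eq0 -lt0n.
Qed.

End residual_weights.

(** * Means of the resampled particles *)

Section resample_means.
Context (R : realType) (X : Type) (m n : nat) (hm : (0 < m)%N).
Variables (xi : 'I_m -> X) (w : 'I_m -> R) (f : X -> R).

(** The [0] matches the constant [a] of [variance_iid]. *)
Lemma resample_mean_mult (u : 'I_n -> R) :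
  resample_mean n f (mult_resample hm xi w u) =
  n%:R^-1 * (0 + \sum_k f (xi (Dinv hm w (u k)))).
Proof. by rewrite /resample_mean /mult_resample big_map big_enum/= add0r. Qed.

Lemma resample_mean_resid (u : 'I_(nresid n w) -> R) :
  resample_mean n f (resid_resample hm xi w u) =
  n%:R^-1 * (\sum_i f (xi i) *+ ncopies n w i +
             \sum_k f (xi (Dinv hm (resid_weight n w) (u k)))).
Proof.
rewrite /resample_mean /resid_resample big_cat big_flatten !big_map.
rewrite -!enumT !big_enum; congr (_ * (_ + _)); apply: eq_bigr => i _.
by rewrite big_nseq -Monoid.iteropE.
Qed.

End resample_means.

(** * Comparison of the three variances *)

Theorem mainTheorem3 (R : realType) (d : measure_display)
    (T : measurableType d) (P : probability T R)
    (X : Type) (m n : nat) (hm : (0 < m)%N) (hn : (0 < n)%N)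
    (xi : 'I_m -> X) (w : 'I_m -> R)
    (w_ge0 : forall i, 0 <= w i) (w_sum1 : \sum_(i < m) w i = 1)
    (f : X -> R)
    (Urs Ures : 'I_(nresid n w) -> {RV P >-> R}) (Umult : 'I_n -> {RV P >-> R})
    (hUrs : stratified_uniform Urs) (hUres : iid_uniform Ures)
    (hUmult : iid_uniform Umult) :
  ('V_P[fun t => resample_mean n f (resid_resample hm xi w (fun k => Urs k t))]
   <= 'V_P[fun t => resample_mean n f
                      (resid_resample hm xi w (fun k => Ures k t))])%E
  /\
  ('V_P[fun t => resample_mean n f
                   (resid_resample hm xi w (fun k => Ures k t))]
   <= 'V_P[fun t => resample_mean n f
                      (mult_resample hm xi w (fun k => Umult k t))])%E.
Proof.
have wr0 := resid_weight_ge0 n w_ge0.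
have wr1 := @resid_weight_sum1 _ _ n _ w_ge0 w_sum1.
pose h i := f (xi i).
pose S (p : 'I_m -> R) := \sum_i (h i - \sum_j h j * p j) ^+ 2 * p i.
pose a := \sum_i h i *+ ncopies n w i.
have resE (U : 'I_(nresid n w) -> {RV P >-> R}) :
    (fun t => resample_mean n f (resid_resample hm xi w (fun k => U k t))) =
    (fun t => n%:R^-1 * (a + \sum_k h (Dinv hm (resid_weight n w) (U k t)))).
  by apply/funext => t; rewrite resample_mean_resid.
have resV : ('V_P[fun t => resample_mean n f
                   (resid_resample hm xi w (fun k => Ures k t))])%E =
    (n%:R^-1 ^+ 2 * ((nresid n w)%:R * S (resid_weight n w)))%:E.
  by rewrite resE (variance_iid hm wr0 wr1 h).
rewrite resV; split.
  by rewrite resE; exact: (variance_stratified_le hm wr0 wr1 h).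
under [X in ('V__[X])%E]eq_fun do rewrite resample_mean_mult.
rewrite (variance_iid hm w_ge0 _ h)// lee_fin ler_wpM2l ?sqr_ge0//.
set M := \sum_j h j * w j.
apply: (@le_trans _ _ ((nresid n w)%:R *
    \sum_i (h i - M) ^+ 2 * resid_weight n w i)).
  (* Without residual draws the residual weights do not sum to 1, but both sides then carry the
     factor 0. *)
  have [->|N_gt0] := posnP (nresid n w); first by rewrite !mul0r.
  by rewrite ler_wpM2l//; apply: sum_sqr_dev_le; exact: wr1.
(* Termwise, by [resid_weightE], the coefficients of [(h i - M) ^+ 2] differ by [ncopies n w i],
   which is nonnegative. *)
rewrite !mulr_sumr ler_sum// => i _; rewrite mulrCA [leRHS]mulrCA.
by rewrite ler_wpM2l ?sqr_ge0// -(resid_weightE n w_ge0 w_sum1 i) lerDr.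
Qed.
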